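(* Let $\omega$ be a state and let $\langle\cdot,\cdot\rangle$ be a clustering form on $\mathcal O$ with respect to $\omega$. Let $\mathcal H$ be the Hilbert space obtained by Cauchy completing the quotient of $\mathcal O$ by the null space $\{A:\langle A,A\rangle=0\}$ (elements of $\mathcal O$ being identified with their classes). Then for every $A\in\mathcal H$, the linear functional $B\mapsto\langle A,B\rangle$ on $\mathcal O$ is a weakly clustering linear functional with respect to $\omega$.
   Context: Setting: Fix $D\ge1$, $\mathbb Z^D$ with $\mathrm{dist}(x,y)=\sum_i|x_i-y_i|$. $\mathcal O$ is a complex normed space with distinguished $\mathbf 1$ of norm 1, with finite-dimensional subspaces $\mathcal O_X$ ($X\subset\mathbb Z^D$ finite), $\mathcal O_\emptyset=\mathbb C\mathbf 1$, $X\subset Y\Rightarrow\mathcal O_X\subset\mathcal O_Y$, $\mathcal O_X\cap\mathcal O_Y=\mathcal O_{X\cap Y}$, $\mathcal O=\bigcup_X\mathcal O_X$. $\mathrm{supp}(A)$ is the smallest $X$ with $A\in\mathcal O_X$; $|A|:=|\mathrm{supp}(A)|$; $\mathrm{dist}(A,B)$ is the distance between supports ($\mathrm{dist}(A,\mathbf 1)=\infty$); $\mathrm{diam}(A)$ is the maximal distance between points of $\mathrm{supp}(A)$; $\mathtt B(L)=\{x:\mathrm{dist}(x,0)\le L\}$. The completion $\mathcal A$ is a unital $C^*$-algebra, each $\mathcal O_X$ a $C^*$-subalgebra, elements with disjoint supports commute and their product's support is the union. Translations $\iota_x$ are $*$-automorphisms with $\iota_x\iota_y=\iota_{x+y}$,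 $\mathrm{supp}(\iota_x A)=\mathrm{supp}(A)+x$. A state is a positive normalized linear functional on $\mathcal A$. Clustering form w.r.t. $\omega$: a translation-invariant ($\langle\iota_x A,B\rangle=\langle A,\iota_x B\rangle=\langle A,B\rangle$) positive semi-definite sesquilinear form on $\mathcal O$ such that (I) there exist $\nu:\mathbb N\to\mathbb R^+$, $f:\mathbb Z\to\mathbb R^+$ and $p>D$ with $f(d)\le d^{-p}$ for $d>0$ such that for all $\ell$ and $A,B,C\in\mathcal O$ with $|A|,|B|,|C|<\ell$: $|\langle A,BC\rangle-\langle A,B\rangle\omega(C)-\langle A,C\rangle\omega(B)|\le\nu(\ell)\|A\|\|B\|\|C\|f(\mathrm{dist}(B,C)-\mathrm{diam}(A))$; (II) for every $\ell>0$ there is $\kappa>0$ with $|\langle A,B\rangle|\le\kappa\|A\|\|B\|$ for all $A,B$ with $|A|,|B|<\ell$. Weakly clustering linear functional w.r.t. $\omega$: a translation-invariant linear functional $P$ on $\mathcal O$ with $P(\mathbf 1)=0$ such that (I) for every $\ell,w>0$, $\lim_{\mathrm{dist}(A,B)\to\infty}P(AB)=P(A)\omega(B)+P(B)\omega(A)$ uniformly over $A,B\in\mathcal O$ with $|A|,|B|<\ell$, $\|A\|,\|B\|<w$; (II) for every $A,B\in\mathcal O$, $\lim_{L\to\infty}L^{-D+1/2}\sum_{x\in\mathtt B(L)}\big(P(\iota_x(A)B)-P(A)\omega(B)-P(B)\omega(A)\big)=0$. *)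

(* Defs.v *)
From HB Require Import structures.
From Stdlib Require Import Rdefinitions Rpower.
From mathcomp Require Import all_boot all_order all_algebra.
From mathcomp Require Import finmap.
From mathcomp Require Import Rstruct.
From mathcomp Require Import complex.

Set Implicit Arguments.
Unset Strict Implicit.
Unset Printing Implicit Defensive.

Import Order.TTheory GRing.Theory Num.Theory.
Local Open Scope ring_scope.


Notation Rl := Rdefinitions.R.
Notation Cx := (complex Rdefinitions.R).

Definition cnorm (z : Cx) : Rl :=
  Num.sqrt (complex.Re z ^+ 2 + complex.Im z ^+ 2).

Definition cconj (z : Cx) : Cx := conjc z.

Definition site (D : nat) := 'rV[int]_D.

Definition l1 (D : nat) (x : site D) : nat := (\sum_(i < D) `|x ord0 i|%N)%N.

Definition l1dist (D : nat) (x y : site D) : nat := l1 (x - y).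

(* distance between finite sets of sites; None stands for +infinity
   (one of the two sets is empty) *)
Definition sdist (D : nat) (X Y : {fset site D}) : option nat :=
  let s := [seq l1dist x y | x <- enum_fset X, y <- enum_fset Y] in
  if s is d :: s' then Some (foldr minn d s') else None.

(* diameter of a finite set of sites (0 for the empty set) *)
Definition sdiam (D : nat) (X : {fset site D}) : nat :=
  foldr maxn 0%N [seq l1dist x y | x <- enum_fset X, y <- enum_fset X].

Definition stransl (D : nat) (X : {fset site D}) (x : site D) : {fset site D} :=
  [fset (y + x)%R | y in X]%fset.

(* enumeration of the ball  B(L) = { x : dist(x,0) <= L }  (without repetition) *)
Definition ball_pt (D L : nat) (k : {ffun 'I_D -> 'I_(2 * L).+1}) : site D :=
  \row_i ((k i : nat)%:Z - L%:Z).

Definition ball (D L : nat) : seq (site D) :=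
  [seq ball_pt k | k <- enum {ffun 'I_D -> 'I_(2 * L).+1} & (l1 (ball_pt k) <= L)%N].

(* O : the complex *-algebra of local observables, with (C*-)norm nrm,
   local subspaces loc X = O_X, support supp, translations iota. *)
Record quasi_local (D : nat) (O : algType Cx) (star : O -> O) (nrm : O -> Rl)
    (loc : {fset site D} -> O -> Prop) (supp : O -> {fset site D})
    (iota : site D -> O -> O) : Prop := QuasiLocal {
  nrm_eq0 : forall A, nrm A = 0 <-> A = 0;
  nrm_triangle : forall A B, nrm (A + B) <= nrm A + nrm B;
  nrm_scale : forall (c : Cx) A, nrm (c *: A) = cnorm c * nrm A;
  nrm_one : nrm 1 = 1;
  (* the completion is a unital C*-algebra: O is a normed *-algebra with
     a C*-norm *)
  star_involutive : forall A, star (star A) = A;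
  star_antilinear : forall (c : Cx) A B, star (c *: A + B) = cconj c *: star A + star B;
  star_mul : forall A B, star (A * B) = star B * star A;
  nrm_mul : forall A B, nrm (A * B) <= nrm A * nrm B;
  nrm_cstar : forall A, nrm (star A * A) = nrm A ^+ 2;
  loc_one : forall X, loc X 1;
  loc_lin : forall X (c : Cx) A B, loc X A -> loc X B -> loc X (c *: A + B);
  loc_mul : forall X A B, loc X A -> loc X B -> loc X (A * B);
  loc_star : forall X A, loc X A -> loc X (star A);
  loc_findim : forall X, exists s : seq O, forall A,
      loc X A <-> exists c : 'I_(size s) -> Cx, A = \sum_(i < size s) c i *: s`_i;
  loc_empty : forall A, loc fset0 A <-> exists c : Cx, A = c%:A;
  loc_mono : forall X Y A, (X `<=` Y)%fset -> loc X A -> loc Y A;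
  loc_cap : forall X Y A, loc X A -> loc Y A -> loc (X `&` Y)%fset A;
  loc_cover : forall A, exists X, loc X A;
  supp_loc : forall A, loc (supp A) A;
  supp_min : forall X A, loc X A -> (supp A `<=` X)%fset;
  disj_comm : forall A B, (supp A `&` supp B)%fset = fset0 -> A * B = B * A;
  disj_supp_mul : forall A B, (supp A `&` supp B)%fset = fset0 -> A != 0 -> B != 0 ->
      supp (A * B) = (supp A `|` supp B)%fset;
  iota_lin : forall x (c : Cx) A B, iota x (c *: A + B) = c *: iota x A + iota x B;
  iota_mul : forall x A B, iota x (A * B) = iota x A * iota x B;
  iota_one : forall x, iota x 1 = 1;
  iota_star : forall x A, iota x (star A) = star (iota x A);
  iota_nrm : forall x A, nrm (iota x A) = nrm A;
  iota0 : forall A, iota 0 A = A;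
  iotaD : forall x y A, iota x (iota y A) = iota (x + y) A;
  iota_supp : forall x A, supp (iota x A) = stransl (supp A) x
}.

Definition osize (D : nat) (O : Type) (supp : O -> {fset site D}) (A : O) : nat :=
  #|` supp A|.
Definition odist (D : nat) (O : Type) (supp : O -> {fset site D}) (A B : O) :=
  sdist (supp A) (supp B).
Definition odiam (D : nat) (O : Type) (supp : O -> {fset site D}) (A : O) : nat :=
  sdiam (supp A).

Definition dist_ge (d : option nat) (r : nat) : Prop :=
  match d with None => True | Some n => (r <= n)%N end.

(* a state: positive normalized linear functional (on the dense
   *-subalgebra O; it is automatically bounded by the norm) *)
Definition is_state (O : algType Cx) (star : O -> O) (nrm : O -> Rl)
    (omega : O -> Cx) : Prop :=
  (forall (c : Cx) A B, omega (c *: A + B) = c * omega A + omega B) /\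
  omega 1 = 1 /\
  (forall A, 0 <= omega (star A * A)) /\
  (forall A, cnorm (omega A) <= nrm A).

Definition clustering_form (D : nat) (O : algType Cx) (nrm : O -> Rl)
    (supp : O -> {fset site D}) (iota : site D -> O -> O)
    (omega : O -> Cx) (form : O -> O -> Cx) : Prop :=
  (forall (c : Cx) A B E, form (c *: A + B) E = cconj c * form A E + form B E) /\
  (forall (c : Cx) A B E, form E (c *: A + B) = c * form E A + form E B) /\
  (forall A, 0 <= form A A) /\
  (forall x A B, form (iota x A) B = form A B /\ form A (iota x B) = form A B) /\
  (exists (nu : nat -> Rl) (f : int -> Rl) (p : Rl),
     (forall l, 0 <= nu l) /\ (forall d, 0 <= f d) /\ (D%:R < p) /\
     (forall d : int, 0 < d -> f d <= Rpower (d%:~R) (- p)) /\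
     forall (l : nat) (A B E : O),
       (osize supp A < l)%N -> (osize supp B < l)%N -> (osize supp E < l)%N ->
       cnorm (form A (B * E) - form A B * omega E - form A E * omega B)
       <= nu l * nrm A * nrm B * nrm E *
          (match odist supp B E with
           | None => 0  (* f(+infinity) = 0 *)
           | Some d => f (d%:Z - (odiam supp A)%:Z)
           end)) /\
  (forall l : nat, (0 < l)%N -> exists kappa : Rl, 0 < kappa /\
     forall A B : O, (osize supp A < l)%N -> (osize supp B < l)%N ->
       cnorm (form A B) <= kappa * nrm A * nrm B).

Definition weakly_clustering (D : nat) (O : algType Cx) (nrm : O -> Rl)
    (supp : O -> {fset site D}) (iota : site D -> O -> O)
    (omega : O -> Cx) (P : O -> Cx) : Prop :=
  (forall (c : Cx) A B, P (c *: A + B) = c * P A + P B) /\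
  (forall x A, P (iota x A) = P A) /\
  P 1 = 0 /\
  (forall (l : nat) (w : Rl), (0 < l)%N -> 0 < w ->
     forall eps : Rl, 0 < eps -> exists r : nat, forall A B : O,
       (osize supp A < l)%N -> (osize supp B < l)%N -> nrm A < w -> nrm B < w ->
       dist_ge (odist supp A B) r ->
       cnorm (P (A * B) - (P A * omega B + P B * omega A)) < eps) /\
  (forall A B : O, forall eps : Rl, 0 < eps -> exists L0 : nat, forall L : nat,
     (L0 <= L)%N ->
     cnorm (((Num.sqrt (L%:R : Rl) / (L%:R ^+ D))%:C)%C *
            \sum_(x <- ball D L) (P (iota x A * B) - P A * omega B - P B * omega A))
     < eps).

(* Cauchy sequences in O for the form seminorm; they represent the
   elements of the completion H of O / null space *)
Definition form_cauchy (O : algType Cx) (form : O -> O -> Cx) (a : nat -> O) : Prop :=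
  forall eps : Rl, 0 < eps -> exists N : nat, forall m n : nat,
    (N <= m)%N -> (N <= n)%N -> cnorm (form (a m - a n) (a m - a n)) < eps.

Definition ccvg (u : nat -> Cx) (z : Cx) : Prop :=
  forall eps : Rl, 0 < eps -> exists N : nat, forall n : nat, (N <= n)%N -> cnorm (u n - z) < eps.

(* Main.v *)
Require Import Defs.
From HB Require Import structures.
From Stdlib Require Import Rdefinitions Rpower.
From Stdlib Require Import RIneq Rtrigo_def Exp_prop Rseries Rcomplete.
From mathcomp Require Import all_boot all_order all_algebra.
From mathcomp Require Import finmap.
From mathcomp Require Import Rstruct.
From mathcomp Require Import complex.
From mathcomp Require Import zify ring lra.
Import Order.TTheory GRing.Theory Num.Theory.
Local Open Scope ring_scope.

(** Approximate P by <C, -> with C local: by Cauchy-Schwarz the error on B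
    is at most e <B, B>^(1/2).  Condition (I) then follows from clustering of C.

    For condition (II), write T_x = iota_x(A) B - omega(B) iota_x(A) - omega(A) B
    and let S be the sum of T_x over the ball of radius L.  Clustering of the
    local observable C bounds <C, T_x> by the p-th inverse power of |x|, and
    since diam(T_x) <= |x| + const it bounds <T_x, T_y> by the p-th inverse power
    of ||x| - |y||.  Spheres contain O(L^(D-1)) points and p > 1, so
    <C, S> = O(L^(D-1)) and <S, S> = O(L^(2D-1)), whence |P(S)| is at most
    e O(L^(D-1/2)) + O(L^(D-1)) for every e > 0.

    Clustering produces omega(iota_x A) rather than omega(A), and omega is not
    assumed invariant; but if the form is nonzero then its own translation
    invariance forces omega to be invariant. *)

(* Real literals and operations are those of MathComp, not of R_scope. *)
Bind Scope ring_scope with R.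
Local Arguments Rpower (x y)%_ring_scope.
Local Arguments exp x%_ring_scope.

(** * Complex moduli and positive forms *)

Lemma cnormE (z : Cx) : `|z| = (cnorm z)%:C%C.
Proof. exact: normc_def. Qed.

Lemma cnorm_ge0 (z : Cx) : 0 <= cnorm z.
Proof. exact: sqrtr_ge0. Qed.

Lemma cnormD (x y : Cx) : cnorm (x + y) <= cnorm x + cnorm y.
Proof. by rewrite -lecR rmorphD /= -!cnormE ler_normD. Qed.

Lemma cnormM (x y : Cx) : cnorm (x * y) = cnorm x * cnorm y.
Proof. by apply: complexI; rewrite rmorphM /= -!cnormE normrM. Qed.

Lemma cnormN (x : Cx) : cnorm (- x) = cnorm x.
Proof. by apply: complexI; rewrite -!cnormE normrN. Qed.

Lemma cnormB (x y : Cx) : cnorm (x - y) <= cnorm x + cnorm y.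
Proof. by rewrite -(cnormN y) cnormD. Qed.

Lemma cnorm0 : cnorm 0 = 0.
Proof. by apply: complexI; rewrite -!cnormE normr0. Qed.

Lemma cnorm_eq0 (x : Cx) : cnorm x = 0 -> x = 0.
Proof. by move=> h; apply/normr0_eq0; rewrite cnormE h. Qed.

Lemma cnormR (r : Rl) : cnorm (r%:C)%C = `|r|.
Proof. by rewrite /cnorm /= expr0n addr0 sqrtr_sqr. Qed.

Lemma cnorm_conj (x : Cx) : cnorm (cconj x) = cnorm x.
Proof. by case: x => a b; rewrite /cnorm /= sqrrN. Qed.

Lemma sqr_cnorm (z : Cx) :
  cnorm z ^+ 2 = complex.Re z ^+ 2 + complex.Im z ^+ 2.
Proof. by rewrite sqr_sqrtr // addr_ge0 ?sqr_ge0. Qed.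

Lemma ge_absRe_cnorm (z : Cx) : `|complex.Re z| <= cnorm z.
Proof. by rewrite -sqrtr_sqr ler_sqrt ?lerDl ?sqr_ge0 // addr_ge0 ?sqr_ge0. Qed.

Lemma ge_absIm_cnorm (z : Cx) : `|complex.Im z| <= cnorm z.
Proof. by rewrite -sqrtr_sqr ler_sqrt ?lerDr ?sqr_ge0 // addr_ge0 ?sqr_ge0. Qed.

Lemma cnorm_le_ReIm (z : Cx) : cnorm z <= `|complex.Re z| + `|complex.Im z|.
Proof.
rewrite -(ler_pXn2r (ltn0Sn 1)) ?nnegrE ?cnorm_ge0 ?addr_ge0 //.
rewrite sqr_cnorm sqrrD !real_normK ?num_real //.
have := mulr_ge0 (normr_ge0 (complex.Re z)) (normr_ge0 (complex.Im z)).
lra.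
Qed.

Lemma cnorm_sum (I : Type) (r : seq I) (F : I -> Cx) :
  cnorm (\sum_(i <- r) F i) <= \sum_(i <- r) cnorm (F i).
Proof.
elim/big_ind2: _ => [|x1 x2 y1 y2 h1 h2|i _ //]; first by rewrite cnorm0.
exact: le_trans (cnormD _ _) (lerD h1 h2).
Qed.

Lemma Cx_ge0 (z : Cx) : 0 <= z -> complex.Im z = 0 /\ 0 <= complex.Re z.
Proof. by rewrite lecE => /andP[/eqP -> ->]. Qed.

Section PositiveForm.
Variables (O : lmodType Cx) (form : O -> O -> Cx).
Hypothesis formL : forall (c : Cx) A B E,
  form (c *: A + B) E = cconj c * form A E + form B E.
Hypothesis formR : forall (c : Cx) A B E,
  form E (c *: A + B) = c * form E A + form E B.
Hypothesis form_ge0 : forall A, 0 <= form A A.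

(** Polarization: reality of the form at [A + B] and at [iA + B] settles the imaginary and the real
    part respectively. *)
Lemma form_conj A B : form B A = cconj (form A B).
Proof.
have [a0 _] := Cx_ge0 _ (form_ge0 A).
have [b0 _] := Cx_ge0 _ (form_ge0 B).
have [h1 _] := Cx_ge0 _ (form_ge0 (1 *: A + B)).
have [h2 _] := Cx_ge0 _ (form_ge0 (('i)%C *: A + B)).
move: h1 h2; rewrite !formL !formR.
move: a0 b0.
case: (form A A) => a a'; case: (form B B) => b b'.
case: (form A B) => x y; case: (form B A) => u v /= -> -> h1 h2.
by congr Complex; lra.
Qed.

(** Positivity at [(t * form A B) *: A + B] with [t] real gives a real quadratic in [t]; when
    [a > 0] it is evaluated at its minimum [- 1 / a]. *)
Lemma form_Cauchy_Schwarz A B :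
  cnorm (form A B) ^+ 2 <= complex.Re (form A A) * complex.Re (form B B).
Proof.
have [a0 ap] := Cx_ge0 _ (form_ge0 A).
have [b0 bp] := Cx_ge0 _ (form_ge0 B).
have h (t : Rl) : 0 <= t ^+ 2 * (cnorm (form A B) ^+ 2) * complex.Re (form A A)
     + 2 * t * cnorm (form A B) ^+ 2 + complex.Re (form B B).
  have [_] := Cx_ge0 _ (form_ge0 ((t%:C%C * form A B) *: A + B)).
  rewrite !formL !formR (form_conj A B) !sqr_cnorm.
  move: a0 b0.
  case: (form A A) => a a'; case: (form B B) => b b'.
  case: (form A B) => x y /= -> _ h; apply: le_trans h _; rewrite le_eqVlt; apply/orP; left; apply/eqP; ring.
move: h ap bp; set N := _ ^+ 2; set a := complex.Re (form A A).
set b := complex.Re _ => h ap bp.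
have N0 : 0 <= N by rewrite sqr_ge0.
have [a1|a1] := eqVneq a 0.
  have [->|N1] := eqVneq N 0; first by rewrite a1 mul0r.
  (* With [a = 0] the quadratic is affine, and this [t] gives it the value -1. *)
  have := h (- (b + 1) / (2 * N)); rewrite a1.
  have -> : 2 * (- (b + 1) / (2 * N)) * N = - (b + 1) by field.
  lra.
have ap' : 0 < a by rewrite lt_neqAle eq_sym a1.
have := h (- a^-1).
have -> : (- a^-1) ^+ 2 * N * a + 2 * - a^-1 * N + b = b - N / a by field.
by rewrite subr_ge0 ler_pdivrMr // mulrC.
Qed.

End PositiveForm.

(** * Decay and sums over balls *)

(* With truncated subtraction, the value at [0] covers all the cases
   [dist <= diam], where only the boundedness hypothesis (II) applies. *)
Definition decay (p : Rl) (n : nat) : Rl :=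
  if n is 0 then 1 else Rpower n%:R (- p).

Lemma Rpower_gt0 (x y : Rl) : 0 < Rpower x y.
Proof. by apply/RltP; apply: exp_pos. Qed.

Lemma decay_ge0 p n : 0 <= decay p n.
Proof. by case: n => [|n] /=; rewrite ?ler01 // ltW // Rpower_gt0. Qed.

Lemma decay_nonincreasing p m n : 0 <= p -> (m <= n)%N -> decay p n <= decay p m.
Proof.
move=> p0; case: m n => [|m] [|n] //= mn.
  rewrite -[leRHS](Rpower_O n.+1%:R); last by apply/RltP; rewrite ltr0n.
  by apply/RleP/Rle_Rpower; apply/RleP; rewrite ?ler1n // oppr_le0.
rewrite !Rpower_Ropp !RinvE lef_pV2 ?posrE ?Rpower_gt0 //.
apply/RleP/Rle_Rpower_l; first exact/RleP.
by split; [apply/RltP; rewrite ltr0n | apply/RleP; rewrite ler_nat].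
Qed.

Lemma decay_le_inv p n : 1 <= p -> decay p n.+1 <= n.+1%:R^-1.
Proof.
move=> p1; have n0 : (0 < n.+1%:R :> Rl) by rewrite ltr0n.
rewrite -[X in _ <= X]RinvE -[X in _ <= Rinv X]Rpower_1; last exact/RltP.
rewrite -Rpower_Ropp; apply/RleP/Rle_Rpower; apply/RleP.
  by rewrite ler1n.
by rewrite lerN2.
Qed.

(** The comparison behind the integral test, from [1 + u <= exp u] alone: [u = - 1 / y] gives
    [ln x <= ln y - 1 / y], and [u = q * (ln y - ln x)] then compares the two powers. *)
Lemma decay_telescope (q : Rl) (d : nat) : 0 < q ->
  q * decay (q + 1) d.+2 <= Rpower d.+1%:R (- q) - Rpower d.+2%:R (- q).
Proof.
move=> q0 /=; set x : Rl := d.+1%:R; set y : Rl := d.+2%:R.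
have x0 : 0 < x by rewrite ltr0n.
have y0 : 0 < y by rewrite ltr0n.
have yx : x = y - 1 by rewrite /x /y -[d.+2%:R]natr1 addrK.
have yV : Rpower y (- (q + 1)) = Rpower y (- q) / y.
  rewrite opprD Rpower_plus; congr (_ * _).
  by rewrite Rpower_Ropp Rpower_1 //; apply/RltP.
have lnxy : ln x <= ln y - y^-1.
  have -> : x = y * (1 - y^-1) by rewrite yx mulrBr mulr1 divff // gt_eqF.
  have h0 : 0 < 1 - y^-1 by rewrite subr_gt0 invf_lt1 // ltr1n.
  rewrite ln_mult; [|exact/RltP|exact/RltP].
  rewrite lerD2l; have := exp_ineq1_le (- y^-1) => /RleP h.
  rewrite -[leRHS]ln_exp; move: h; rewrite RplusE !le_eqVlt.
  case/predU1P => [->|h]; first by rewrite eqxx.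
  by apply/orP; right; apply/RltP/ln_increasing; apply/RltP.
have hx : Rpower x (- q) = Rpower y (- q) * exp (q * (ln y - ln x)).
  by rewrite /Rpower expRD; congr exp; rewrite !RmultE RplusE; ring.
have := exp_ineq1_le (q * (ln y - ln x)) => /RleP h.
have h2 : q * y^-1 <= q * (ln y - ln x) by rewrite ler_pM2l // lerBrDr addrC -lerBrDr.
rewrite hx yV mulrCA -[X in _ <= _ - X]mulr1 -mulrBr ler_pM2l ?Rpower_gt0 //.
by apply: (le_trans h2); rewrite lerBrDl.
Qed.

Lemma decay_summable (p : Rl) : 1 < p ->
  exists H : Rl, 0 <= H /\ forall N, \sum_(0 <= d < N) decay p d <= H.
Proof.
move=> p1; set q := p - 1; have q0 : 0 < q by rewrite subr_gt0.
have pq : p = q + 1 by rewrite subrK.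
have qn n : 0 < Rpower n%:R (- q) by apply: Rpower_gt0.
(* The 2 pays for the terms at 0 and 1, both equal to 1; the later terms telescope. *)
have h N : \sum_(0 <= d < N.+2) decay p d <= 2 + q^-1 * (1 - Rpower N.+1%:R (- q)).
  elim: N => [|N IH].
    rewrite !big_nat_recr //= big_nil add0r.
    by rewrite /Rpower ln_1 !RmultE !mulr0 exp_0 !R1E subrr mulr0 addr0.
  rewrite big_nat_recr //=; apply: le_trans (lerD IH (lexx _)) _.
  have := decay_telescope q N q0; rewrite -pq -ler_pdivlMl //=; lra.
have b N : \sum_(0 <= d < N.+2) decay p d <= 2 + q^-1.
  apply: le_trans (h N) _; rewrite lerD2l ger_pMr ?invr_gt0 //.
  by have := qn N.+1; lra.
exists (2 + q^-1); split=> [|N]; first by rewrite addr_ge0 // invr_ge0 ltW.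
apply: le_trans (b N); rewrite !big_nat_recr //= -addrA lerDl.
by rewrite addr_ge0 ?decay_ge0 // ltW // Rpower_gt0.
Qed.

(** Truncation sends the first [c] arguments to 0, and these terms cost at most 1 each; the others
    form an unshifted partial sum. *)
Lemma sum_shift_le (g : nat -> Rl) (H : Rl) (c N : nat) :
  (forall d, g d <= 1) -> (forall d, 0 <= g d) -> g 0%N = 1 ->
  (forall M, \sum_(0 <= d < M) g d <= H) ->
  \sum_(0 <= d < N) g (d - c)%N <= c%:R + H.
Proof.
move=> g1 g0 g01 gH.
apply: (@le_trans _ _ (\sum_(0 <= d < c + N) g (d - c)%N)).
  rewrite [leRHS](big_cat_nat (n := N)) ?leq_addl //= lerDl.
  by apply: sumr_ge0.
rewrite (big_cat_nat (n := c)) ?leq_addr //=; apply: lerD.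
  apply: le_trans (ler_sum _ (fun i _ => g1 _)) _.
  by rewrite big_const_nat subn0 iter_addr_0.
rewrite -{1}[c]add0n big_addn addKn.
by under eq_bigr do rewrite addnK.
Qed.

(** In truncated arithmetic [(r - s) + (s - r)] is the absolute difference. Each value occurs at
    most once on either side of [s], hence the factor 2. *)
Lemma sum_absdiff_le (g : nat -> Rl) (H : Rl) (s N : nat) :
  (forall d, 0 <= g d) -> (forall M, \sum_(0 <= d < M) g d <= H) ->
  \sum_(0 <= r < N) g ((r - s) + (s - r))%N <= 2 * H.
Proof.
move=> g0 gH.
apply: (@le_trans _ _ (\sum_(0 <= r < s + N) g ((r - s) + (s - r))%N)).
  rewrite [leRHS](big_cat_nat (n := N)) ?leq_addl //= lerDl.
  by apply: sumr_ge0.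
rewrite (big_cat_nat (n := s)) ?leq_addr //= mulr_natl mulr2n; apply: lerD.
  rewrite big_nat_rev /= add0n; apply: le_trans (gH s.+1).
  rewrite big_nat_recl //= -[leLHS]add0r lerD //.
  rewrite le_eqVlt; apply/orP; left; apply/eqP/eq_big_nat => i /andP[_ h].
  by congr g; lia.
rewrite -{1}[s]add0n big_addn addKn.
rewrite (_ : \sum_(0 <= i < N) _ = \sum_(0 <= d < N) g d) //.
by apply: eq_bigr => i _; congr g; lia.
Qed.

Section BallSums.
Variables (D L : nat).
Implicit Type k : {ffun 'I_D.+1 -> 'I_(2 * L).+1}.

Lemma l1_ball_pt k : l1 (ball_pt k) = (\sum_(i < D.+1) ((k i - L) + (L - k i)))%N.
Proof.
by apply: eq_bigr => i _; rewrite mxE; lia.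
Qed.

(* A point of a sphere is determined by its last [D] coordinates and the sign
   of the first one. *)
Lemma card_sphere (r : nat) :
  (#|[set k : {ffun 'I_D.+1 -> 'I_(2 * L).+1} | l1 (ball_pt k) == r]| <= 2 * (2 * L).+1 ^ D)%N.
Proof.
pose phi k : bool * {ffun 'I_D -> 'I_(2 * L).+1} :=
  ((k ord0 <= L)%N, [ffun i => k (lift ord0 i)]).
have phiI : {in [set k : {ffun 'I_D.+1 -> 'I_(2 * L).+1} | l1 (ball_pt k) == r] &, injective phi}.
  move=> k k'; rewrite !inE !l1_ball_pt !big_ord_recl /= => /eqP hk /eqP hk'.
  move=> [h0 /ffunP hS].
  have hS' i : k (lift ord0 i) = k' (lift ord0 i) by have := hS i; rewrite !ffunE.
  have eS : (\sum_(i < D) (k (lift ord0 i) - L + (L - k (lift ord0 i))) =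
    \sum_(i < D) (k' (lift ord0 i) - L + (L - k' (lift ord0 i))))%N.
    by apply: eq_bigr => i _; rewrite hS'.
  apply/ffunP => i; case: (unliftP ord0 i) => [j ->|->]; first exact: hS'.
  apply: val_inj => /=; move: hk hk' h0; rewrite eS.
  move: (\sum_(_ < D) _)%N (nat_of_ord (k ord0)) (nat_of_ord (k' ord0)) => s u v.
  by case: (leqP u L); case: (leqP v L) => //; lia.
rewrite -(card_in_imset phiI); apply: leq_trans (max_card _) _.
by rewrite card_prod card_bool card_ffun !card_ord.
Qed.

Lemma sum_ball_sphere (G : nat -> Rl) : (forall n, 0 <= G n) ->
  \sum_(x <- ball D.+1 L) G (l1 x) <=
  (2 * (2 * L).+1 ^ D)%:R * \sum_(0 <= r < L.+1) G r.
Proof.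
move=> G0; rewrite /ball big_map big_filter big_enum_cond /=.
(* Points are grouped by radius. The ball condition keeps the radius at most [L], so [inord] loses
   nothing. *)
rewrite (partition_big (fun k : {ffun 'I_D.+1 -> 'I_(2 * L).+1} => inord (l1 (ball_pt k)) : 'I_L.+1) xpredT) //=.
rewrite big_mkord mulr_sumr; apply: ler_sum => r _.
rewrite (eq_bigr (fun=> G r)); last first.
  by move=> k /andP[h /eqP <-]; rewrite inordK // ltnS.
rewrite sumr_const -[leLHS]mulr_natl ler_wpM2r // ler_nat.
apply: leq_trans (card_sphere r); apply: subset_leq_card; apply/subsetP => k.
by rewrite inE unfold_in => /andP[h /eqP <-]; rewrite inordK // ltnS.
Qed.

End BallSums.

(** Since [2L + 1 <= 3L] for [L > 0], the sphere count becomes a constant times [L ^ (D - 1)], and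
    radial sums over the ball reduce to one-dimensional ones. *)
Lemma sum_ball_le (D L : nat) (G : nat -> Rl) : (0 < D)%N -> (0 < L)%N ->
  (forall n, 0 <= G n) ->
  \sum_(x <- ball D L) G (l1 x) <=
  (2 * 3 ^ D.-1)%:R * L%:R ^+ D.-1 * \sum_(0 <= r < L.+1) G r.
Proof.
case: D => // D _ L0 G0; apply: le_trans (sum_ball_sphere _ _ _ G0) _.
rewrite ler_wpM2r ?sumr_ge0 // -natrX -natrM ler_nat -mulnA leq_mul2l /=.
by rewrite -expnMn; case: (D) => // n; rewrite leq_exp2r //; lia.
Qed.

(** * Lattice geometry and limits *)

Lemma decay_small (p eps : Rl) : 1 <= p -> 0 < eps ->
  exists r, forall n, (r <= n)%N -> decay p n < eps.
Proof.
move=> p1 e0; have [N hN] : exists N : nat, eps^-1 < N%:R.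
  by exists (Num.bound eps^-1); have := archi_boundP (ltW (_ : 0 < eps^-1)); apply; rewrite invr_gt0.
exists N.+1 => -[//|n] hn; apply: le_lt_trans (decay_le_inv p n p1) _.
rewrite invf_plt ?posrE ?ltr0n //; apply: lt_le_trans hN _.
by rewrite ler_nat ltnW.
Qed.

Section Geometry.
Variable D : nat.
Implicit Types (x y : site D) (X Y : {fset site D}).

Lemma l1D x y : (l1 (x + y)%R <= l1 x + l1 y)%N.
Proof.
rewrite /l1 -big_split; apply: leq_sum => i _ /=; rewrite mxE.
by move: (x _ _ : int) (y _ _ : int) => a b; lia.
Qed.

Lemma l1N x : l1 (- x) = l1 x.
Proof. by apply: eq_bigr => i _; rewrite mxE abszN. Qed.

Lemma l1dist_le x y a b : (l1 x <= a)%N -> (l1 y <= b)%N -> (l1dist x y <= a + b)%N.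
Proof. by move=> hx hy; apply: leq_trans (l1D _ _) _; rewrite l1N leq_add. Qed.

Lemma l1dist_addr x y z : l1dist (x + z) (y + z) = l1dist x y.
Proof. by rewrite /l1dist opprD addrACA subrr addr0. Qed.

Lemma dist_ge_sdist X Y r :
  (forall x y, x \in X -> y \in Y -> (r <= l1dist x y)%N) ->
  dist_ge (sdist X Y) r.
Proof.
move=> h; rewrite /sdist.
have : all (leq r) [seq l1dist x y | x <- enum_fset X, y <- enum_fset Y].
  by apply/allP => d /allpairsP[[x y] [/= hx hy ->]]; apply: h.
case: [seq _ | _ <- _, _ <- _] => [//|d s] /= /andP[hd].
elim: s => [//|e s IH] /= /andP[he hs].
by rewrite leq_min he IH.
Qed.

Lemma sdiam_le X r :
  (forall x y, x \in X -> y \in X -> (l1dist x y <= r)%N) -> (sdiam X <= r)%N.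
Proof.
move=> h; rewrite /sdiam.
have : all (leq^~ r) [seq l1dist x y | x <- enum_fset X, y <- enum_fset X].
  by apply/allP => d /allpairsP[[x y] [/= hx hy ->]]; apply: h.
elim: [seq _ | _ <- _, _ <- _] => [//|d s IH] /= /andP[hd hs].
by rewrite geq_max hd IH.
Qed.

Lemma fset_bounded X : exists M, forall x, x \in X -> (l1 x <= M)%N.
Proof.
exists (\max_(x <- enum_fset X) l1 x)%N => x xX.
exact: (@leq_bigmax_seq _ (enum_fset X) predT (@l1 D)).
Qed.

Lemma stranslP X x y : reflect (exists2 u, u \in X & y = u + x) (y \in stransl X x).
Proof. exact: (iffP (imfsetP _ _ _ _)). Qed.

Lemma card_stransl X x : #|` stransl X x| = #|` X|.
Proof. by rewrite card_imfset //; apply: addIr. Qed.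

(** The common shift [y] cancels, so the separation is uniform in [y]; the rest is the triangle
    inequality for [z - (u - v)]. *)
Lemma dist_stransl X Y M y z :
  (forall u, u \in X -> (l1 u <= M)%N) -> (forall u, u \in Y -> (l1 u <= M)%N) ->
  dist_ge (sdist (stransl X y) (stransl Y (y + z))) (l1 z - 2 * M)%N.
Proof.
move=> hX hY; apply: dist_ge_sdist => _ _ /stranslP[u uX ->] /stranslP[v vY ->].
have -> : l1dist (u + y) (v + (y + z)) = l1 (z - (u - v)).
  by rewrite /l1dist -l1N; congr l1; apply/rowP => i; rewrite !mxE; ring.
have := l1D (z - (u - v)) (u - v); rewrite subrK.
have := l1D u (- v); rewrite l1N.
by have := hX u uX; have := hY v vY; lia.
Qed.

(** Serves to bound the diameter of the summands of condition (II), which clustering subtracts from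
    the distance. *)
Lemma sdiam_stranslU X Y Z M x : (Z `<=` stransl X x `|` Y)%fset ->
  (forall u, u \in X -> (l1 u <= M)%N) -> (forall u, u \in Y -> (l1 u <= M)%N) ->
  (sdiam Z <= l1 x + 2 * M)%N.
Proof.
move=> /fsubsetP hZ hX hY; apply: sdiam_le => u v /hZ + /hZ.
have hXx w : w \in X -> (l1 (w + x)%R <= M + l1 x)%N.
  by move=> /hX hw; apply: leq_trans (l1D _ _) _; rewrite leq_add2r.
rewrite !inE => /orP[/stranslP[u' hu ->]|hu] /orP[/stranslP[v' hv ->]|hv].
- rewrite l1dist_addr; apply: leq_trans (l1dist_le _ _ _ _ (hX _ hu) (hX _ hv)) _; lia.
- apply: leq_trans (l1dist_le _ _ _ _ (hXx _ hu) (hY _ hv)) _; lia.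
- apply: leq_trans (l1dist_le _ _ _ _ (hY _ hu) (hXx _ hv)) _; lia.
- apply: leq_trans (l1dist_le _ _ _ _ (hY _ hu) (hY _ hv)) _; lia.
Qed.

End Geometry.

Section Limits.
Implicit Types (u v : nat -> Cx) (z : Cx).

Lemma cnorm_small_eq0 z : (forall eps : Rl, 0 < eps -> cnorm z < eps) -> z = 0.
Proof.
move=> h; apply: cnorm_eq0; apply/eqP; rewrite eq_le cnorm_ge0 andbT.
by rewrite leNgt; apply/negP => /h; rewrite ltxx.
Qed.

Lemma ccvg_unique u z z' : ccvg u z -> ccvg u z' -> z = z'.
Proof.
move=> h h'; apply/eqP; rewrite -subr_eq0; apply/eqP/cnorm_small_eq0 => eps e0.
have e2 : 0 < eps / 2 by rewrite divr_gt0.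
have [N hN] := h _ e2; have [N' hN'] := h' _ e2.
have := hN _ (leq_maxl N N'); have := hN' _ (leq_maxr N N').
move: (u _) => t h1 h2.
have -> : z - z' = (t - z') - (t - z) by ring.
by apply: le_lt_trans (cnormB _ _) _; lra.
Qed.

Lemma ccvg_lin (c : Cx) u v z z' :
  ccvg u z -> ccvg v z' -> ccvg (fun n => c * u n + v n) (c * z + z').
Proof.
move=> h h' eps e0; have c0 := cnorm_ge0 c.
have e1 : 0 < eps / (2 * (cnorm c + 1)) by rewrite divr_gt0 //; lra.
have e2 : 0 < eps / 2 by rewrite divr_gt0.
have [N hN] := h _ e1; have [N' hN'] := h' _ e2.
exists (maxn N N') => n; rewrite geq_max => /andP[/hN h1 /hN' h2].
have -> : c * u n + v n - (c * z + z') = c * (u n - z) + (v n - z') by ring.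
apply: le_lt_trans (cnormD _ _) _; rewrite cnormM.
have h3 : cnorm c * cnorm (u n - z) <= cnorm c * (eps / (2 * (cnorm c + 1))).
  by rewrite ler_wpM2l // ltW.
have h4 : cnorm c * (eps / (2 * (cnorm c + 1))) <= eps / 2.
  have -> : cnorm c * (eps / (2 * (cnorm c + 1))) = eps / 2 * (cnorm c / (cnorm c + 1)).
    by field; rewrite gt_eqF //; lra.
  by rewrite ler_piMr ?(ltW e2) // ler_pdivrMr; lra.
lra.
Qed.

Lemma ccvg_cnorm_le u z (w : Cx) (b : Rl) N :
  ccvg u z -> (forall m, (N <= m)%N -> cnorm (u m - w) <= b) -> cnorm (z - w) <= b.
Proof.
move=> h hb; apply/ler_addgt0Pr => eps e0.
have [N' hN'] := h _ e0.
have h1 := hN' _ (leq_maxr N N'); have h2 := hb _ (leq_maxl N N').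
move: h1 h2; move: (u _) => t h1 h2.
have -> : z - w = (t - w) - (t - z) by ring.
by apply: le_trans (cnormB _ _) _; lra.
Qed.

(** The limit is given in a [sig] type so that it can be projected out, observable by observable, to
    define the limit functional. *)
Lemma Rcauchy_cvg (s : nat -> Rl) :
  (forall eps : Rl, 0 < eps -> exists N, forall m n, (N <= m)%N -> (N <= n)%N ->
     `|s m - s n| < eps) ->
  {l : Rl | forall eps : Rl, 0 < eps -> exists N, forall n, (N <= n)%N ->
     `|s n - l| < eps}.
Proof.
move=> h; have [|l hl] := R_complete s.
  move=> eps /RltP/h[N hN]; exists N => m n /ssrnat.leP hm /ssrnat.leP hn.
  by apply/RltP; rewrite RdistE; apply: hN.
exists l => eps /RltP/hl[N hN]; exists N => n /ssrnat.leP hn.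
by have /RltP := hN n hn; rewrite RdistE.
Qed.

Lemma ccauchy_cvg u :
  (forall eps : Rl, 0 < eps -> exists N, forall m n, (N <= m)%N -> (N <= n)%N ->
     cnorm (u m - u n) < eps) -> {z | ccvg u z}.
Proof.
move=> h.
have [|x hx] := Rcauchy_cvg (fun n => complex.Re (u n)).
  move=> eps /h[N hN]; exists N => m n hm hn.
  apply: le_lt_trans (hN m n hm hn); apply: le_trans (ge_absRe_cnorm _).
  by case: (u m); case: (u n).
have [|y hy] := Rcauchy_cvg (fun n => complex.Im (u n)).
  move=> eps /h[N hN]; exists N => m n hm hn.
  apply: le_lt_trans (hN m n hm hn); apply: le_trans (ge_absIm_cnorm _).
  by case: (u m); case: (u n).
exists (Complex x y) => eps e0; have e2 : 0 < eps / 2 by rewrite divr_gt0.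
have [N hN] := hx _ e2; have [N' hN'] := hy _ e2.
exists (maxn N N') => n; rewrite geq_max => /andP[/hN h1 /hN' h2].
apply: le_lt_trans (cnorm_le_ReIm _) _.
by move: h1 h2; case: (u n) => a b /=; lra.
Qed.

End Limits.

(** * Clustering forms *)

Section CauchyForm.
Variables (O : algType Cx) (form : O -> O -> Cx).
Hypothesis formL : forall (c : Cx) A B E,
  form (c *: A + B) E = cconj c * form A E + form B E.
Hypothesis formR : forall (c : Cx) A B E,
  form E (c *: A + B) = c * form E A + form E B.
Hypothesis form_ge0 : forall A, 0 <= form A A.

Definition seminorm A : Rl := Num.sqrt (complex.Re (form A A)).

Lemma cnorm_form_le A B : cnorm (form A B) <= seminorm A * seminorm B.
Proof.
have [_ a0] := Cx_ge0 _ (form_ge0 A).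
rewrite -sqrtrM // -[leLHS]ger0_norm ?cnorm_ge0 // -sqrtr_sqr.
by apply: ler_wsqrtr; apply: form_Cauchy_Schwarz.
Qed.

Lemma formBl A A' B : form (A - A') B = form A B - form A' B.
Proof.
rewrite addrC -scaleN1r formL addrC; congr (_ + _).
by rewrite -[RHS]mulN1r; congr (_ * _); apply/eqP; rewrite eq_complex /= !oppr0 !eqxx.
Qed.

Lemma form0l B : form 0 B = 0.
Proof. by rewrite -(subrr (0 : O)) formBl subrr. Qed.

Lemma formDl A A' B : form (A + A') B = form A B + form A' B.
Proof. by rewrite -{1}[A']opprK formBl -[- A']sub0r formBl form0l sub0r opprK. Qed.

Lemma form0r A : form A 0 = 0.
Proof.
have := formR 1 0 0 A; rewrite scaler0 addr0 mul1r => h.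
by apply: (addrI (form A 0)); rewrite -h addr0.
Qed.

Lemma formDr A B B' : form A (B + B') = form A B + form A B'.
Proof. by rewrite -[B]scale1r formR mul1r scale1r. Qed.

Lemma form_sum_r (I : Type) (s : seq I) (F : I -> O) A :
  form A (\sum_(i <- s) F i) = \sum_(i <- s) form A (F i).
Proof. exact: (big_morph (form A) (formDr A) (form0r A)). Qed.

Lemma form_sum_l (I : Type) (s : seq I) (F : I -> O) B :
  form (\sum_(i <- s) F i) B = \sum_(i <- s) form (F i) B.
Proof. exact: (big_morph (form^~ B) (fun A A' => formDl A A' B) (form0l B)). Qed.

(** By Cauchy-Schwarz the convergence is uniform relative to [seminorm B], so that one local [a n]
    approximates [P] on all observables at once. *)
Lemma cauchy_form_cvg (a : nat -> O) : form_cauchy form a ->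
  exists P : O -> Cx, (forall B, ccvg (fun n => form (a n) B) (P B)) /\
    forall eps : Rl, 0 < eps -> exists N, forall n B, (N <= n)%N ->
      cnorm (P B - form (a n) B) <= eps * seminorm B.
Proof.
move=> ha.
have unif (eps : Rl) : 0 < eps -> exists N, forall m n B, (N <= m)%N -> (N <= n)%N ->
    cnorm (form (a m) B - form (a n) B) <= eps * seminorm B.
  (* The tolerance is [eps] squared because [form_cauchy] controls the square of the seminorm. *)
  move=> e0; have [N hN] := ha _ (mulr_gt0 e0 e0).
  exists N => m n B hm hn; rewrite -formBl.
  apply: le_trans (cnorm_form_le _ _) _; rewrite ler_wpM2r ?sqrtr_ge0 //.
  rewrite -[leRHS]ger0_norm ?(ltW e0) // -sqrtr_sqr ler_sqrt ?sqr_ge0 //.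
  apply: le_trans (ler_norm _) _; apply: le_trans (ge_absRe_cnorm _) _.
  exact: ltW (hN m n hm hn).
have cauchy B (eps : Rl) : 0 < eps -> exists N, forall m n, (N <= m)%N -> (N <= n)%N ->
    cnorm (form (a m) B - form (a n) B) < eps.
  move=> e0; have s0 : 0 <= seminorm B := sqrtr_ge0 _.
  have s1 : 0 < seminorm B + 1 by lra.
  have [N hN] := unif _ (divr_gt0 e0 s1).
  exists N => m n hm hn; apply: le_lt_trans (hN m n B hm hn) _.
  by rewrite mulrAC ltr_pdivrMr // ltr_pM2l //; lra.
pose P B := sval (ccauchy_cvg _ (cauchy B)).
have hP B : ccvg (fun n => form (a n) B) (P B) := svalP (ccauchy_cvg _ (cauchy B)).
exists P; split=> // eps /unif[N hN]; exists N => n B hn.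
by apply: (ccvg_cnorm_le _ _ _ _ N (hP B)) => m hm; apply: hN.
Qed.

End CauchyForm.

Local Arguments seminorm {O} form A.

(** * Local observables and the clustering estimate *)

Section QuasiLocal.
Variables (D : nat) (O : algType Cx) (star : O -> O) (nrm : O -> Rl)
  (loc : {fset site D} -> O -> Prop) (supp : O -> {fset site D})
  (iota : site D -> O -> O).
Hypothesis hO : quasi_local star nrm loc supp iota.
Variable omega : O -> Cx.
Hypothesis homega : is_state star nrm omega.
Variable form : O -> O -> Cx.
Hypothesis hform : clustering_form nrm supp iota omega form.

(** The triangle inequality gives [0 = nrm (A - A) <= 2 * nrm A]. *)
Lemma nrm_ge0 A : 0 <= nrm A.
Proof.
have h0 : nrm 0 = 0 by apply/(nrm_eq0 hO).
have := nrm_triangle hO A ((-1) *: A).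
rewrite (nrm_scale hO) scaleN1r subrr h0.
have -> : cnorm (-1) = 1 by rewrite cnormN -(rmorph1 (real_complex _)) cnormR normr1.
by rewrite mul1r; lra.
Qed.

Lemma cnorm_omega A : cnorm (omega A) <= nrm A.
Proof. by case: homega => _ [_ [_ h]]; apply: h. Qed.

Lemma supp1 : supp 1 = fset0.
Proof. by apply/eqP; rewrite -fsubset0; apply/(supp_min hO)/(loc_one hO). Qed.

Lemma suppM A B : (supp (A * B) `<=` supp A `|` supp B)%fset.
Proof.
apply/(supp_min hO)/(loc_mul hO).
  exact: loc_mono hO _ _ _ (fsubsetUl _ _) (supp_loc hO A).
exact: loc_mono hO _ _ _ (fsubsetUr _ _) (supp_loc hO B).
Qed.

Lemma osize_iota x A : osize supp (iota x A) = osize supp A.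
Proof. by rewrite /osize (iota_supp hO) card_stransl. Qed.

Lemma osize_leU A B E : (supp E `<=` supp A `|` supp B)%fset ->
  (osize supp E <= osize supp A + osize supp B)%N.
Proof.
move=> h; apply: leq_trans (fsubset_leq_card h) _.
by rewrite /osize cardfsU leq_subr.
Qed.

Lemma osizeM_lt A B m n : (osize supp A < m)%N -> (osize supp B < n)%N ->
  (osize supp (A * B)%R < m + n)%N.
Proof.
move=> hA hB; apply: leq_ltn_trans (osize_leU _ _ _ (suppM A B)) _.
by rewrite -addnS leq_add // ltnW.
Qed.

(* The summand of condition (II), before applying the functional. *)
Definition corr (A B : O) (x : site D) : O :=
  (- omega A) *: B + ((- omega B) *: iota x A + iota x A * B).

Lemma supp_corr A B x :
  (supp (corr A B x) `<=` stransl (supp A) x `|` supp B)%fset.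
Proof.
have hB : loc (stransl (supp A) x `|` supp B)%fset B.
  exact: loc_mono hO _ _ _ (fsubsetUr _ _) (supp_loc hO B).
have hA : loc (stransl (supp A) x `|` supp B)%fset (iota x A).
  rewrite -(iota_supp hO).
  exact: loc_mono hO _ _ _ (fsubsetUl _ _) (supp_loc hO _).
apply/(supp_min hO)/(loc_lin hO) => //; apply/(loc_lin hO) => //.
exact: (loc_mul hO).
Qed.

(** Uniform in [x], like the norm bound below: one clustering constant serves the summands at all
    [x]. *)
Lemma osize_corr A B x :
  (osize supp (corr A B x) <= osize supp A + osize supp B)%N.
Proof.
by rewrite -(osize_iota x A); apply: osize_leU; rewrite (iota_supp hO) supp_corr.
Qed.

Lemma nrm_corr A B x : nrm (corr A B x) <= 3 * (nrm A * nrm B).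
Proof.
apply: le_trans (nrm_triangle hO _ _) _; rewrite (nrm_scale hO) cnormN.
have h1 : cnorm (omega A) * nrm B <= nrm A * nrm B.
  by rewrite ler_wpM2r ?nrm_ge0 ?cnorm_omega.
have h2 := nrm_triangle hO ((- omega B) *: iota x A) (iota x A * B).
move: h2; rewrite (nrm_scale hO) cnormN (iota_nrm hO).
have h3 : cnorm (omega B) * nrm A <= nrm A * nrm B.
  by rewrite mulrC ler_wpM2l ?nrm_ge0 ?cnorm_omega.
have := nrm_mul hO (iota x A) B; rewrite (iota_nrm hO).
lra.
Qed.

(** Merges conditions (I) and (II) into one estimate valid at every distance: (I) beyond the
    diameter of [C], boundedness of each of the three terms within it. The exponent does not depend
    on [l]. *)
Lemma clustering_decay : (1 <= D)%N -> exists2 p : Rl, 1 < p &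
  forall l, exists2 K : Rl, 0 <= K & forall (C B E : O) (d : nat),
    (osize supp C < l)%N -> (osize supp B < l)%N -> (osize supp E < l)%N ->
    dist_ge (odist supp B E) d ->
    cnorm (form C (B * E) - form C B * omega E - form C E * omega B)
      <= K * (nrm C * nrm B * nrm E) * decay p (d - odiam supp C).
Proof.
move=> hD; case: hform => _ [_ [_ [_ [[nu [f [p [nu0 [f0 [Dp [fp hcl]]]]]]] hbd]]]].
have p1 : 1 < p by apply: le_lt_trans Dp; rewrite ler1n.
exists p => // l.
have [->|l0] := posnP l; first by exists 0.
(* The size bound is doubled to accommodate the product [B * E]. *)
have [k [k0 hk]] := hbd (l + l)%N (ltn_addr _ l0).
exists (nu l + 3 * k); first by rewrite addr_ge0 ?mulr_ge0 // ltW.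
move=> C B E d hC hB hE hd.
have nC := nrm_ge0 C; have nB := nrm_ge0 B; have nE := nrm_ge0 E.
have n0 : 0 <= nrm C * nrm B * nrm E by rewrite !mulr_ge0.
have [dC|dC] := leqP d (odiam supp C).
  have -> : (d - odiam supp C)%N = 0%N by lia.
  rewrite /= mulr1.
  have h1 : cnorm (form C (B * E)) <= k * (nrm C * nrm B * nrm E).
    apply: le_trans (hk _ _ (ltn_addr _ hC) (osizeM_lt _ _ _ _ hB hE)) _.
    rewrite -!mulrA !(ler_wpM2l, ltW k0) //; exact: nrm_mul hO _ _.
  have h2 : cnorm (form C B * omega E) <= k * (nrm C * nrm B * nrm E).
    rewrite cnormM !mulrA ler_pM ?cnorm_ge0 ?cnorm_omega //.
    by apply: hk; apply: ltn_addr.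
  have h3 : cnorm (form C E * omega B) <= k * (nrm C * nrm B * nrm E).
    rewrite cnormM mulrAC !mulrA ler_pM ?cnorm_ge0 ?cnorm_omega //.
    by apply: hk; apply: ltn_addr.
  have h4 : 0 <= nu l * (nrm C * nrm B * nrm E) by rewrite mulr_ge0.
  have h5 := cnormB (form C (B * E) - form C B * omega E) (form C E * omega B).
  have h6 := cnormB (form C (B * E)) (form C B * omega E).
  lra.
apply: le_trans (hcl l C B E hC hB hE) _; rewrite -!mulrA.
set b := (X in nu l * (_ * (_ * (_ * X)))).
suff hb : b <= decay p (d - odiam supp C).
  rewrite mulrDl; apply: (@le_trans _ _ (nu l * (nrm C * (nrm B * (nrm E * decay p (d - odiam supp C)))))).
    by rewrite !ler_wpM2l.
  by rewrite lerDl !mulr_ge0 ?decay_ge0 // ltW.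
(* At infinite distance the bound in (I) is 0, whatever [d] is. *)
rewrite {}/b; move: hd; case: (odist supp B E) => [n /= hd|_]; last exact: decay_ge0.
have hn : (d - odiam supp C <= n - odiam supp C)%N by rewrite leq_sub2r.
apply: le_trans (decay_nonincreasing _ _ _ _ hn); last by lra.
have -> : n%:Z - (odiam supp C)%:Z = (n - odiam supp C)%N%:Z by lia.
have : (0 < n - odiam supp C)%N by lia.
case: (n - odiam supp C)%N => // q _; exact: fp.
Qed.

(** * Invariance of the state and moments of the ball sums *)

Variable p : Rl.
Hypothesis p1 : 1 < p.
Hypothesis hdecay : forall l, exists2 K : Rl, 0 <= K & forall (C B E : O) (d : nat),
  (osize supp C < l)%N -> (osize supp B < l)%N -> (osize supp E < l)%N ->
  dist_ge (odist supp B E) d ->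
  cnorm (form C (B * E) - form C B * omega E - form C E * omega B)
    <= K * (nrm C * nrm B * nrm E) * decay p (d - odiam supp C).

Lemma formL (c : Cx) A B E :
  form (c *: A + B) E = cconj c * form A E + form B E.
Proof. by case: hform. Qed.

Lemma formR (c : Cx) A B E : form E (c *: A + B) = c * form E A + form E B.
Proof. by case: hform => _ []. Qed.

Lemma form_pos A : 0 <= form A A.
Proof. by case: hform => _ [_ []]. Qed.

Lemma form_iota x A B : form A (iota x B) = form A B.
Proof. by case: hform => _ [_ [_ [h _]]]; case: (h x A B). Qed.

Let p_ge0 : 0 <= p.
Proof. exact: le_trans ler01 (ltW p1). Qed.

Lemma decay_mul_small (K eps : Rl) : 0 <= K -> 0 < eps ->
  exists r, forall n, (r <= n)%N -> K * decay p n < eps.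
Proof.
move=> K0 e0; have K1 : 0 < K + 1 by lra.
have [r hr] := decay_small _ _ (ltW p1) (divr_gt0 e0 K1).
exists r => n /hr; rewrite ltr_pdivlMr // => h.
by have := decay_ge0 p n; lra.
Qed.

(** Clustering with [B = E = 1] leaves only [- form C 1], and empty supports are at infinite
    distance, so the bound is arbitrarily small. *)
Lemma form1r C : form C 1 = 0.
Proof.
have [K K0 hK] := hdecay (osize supp C).+1.
have n0 : 0 <= K * (nrm C * nrm 1 * nrm 1) by rewrite !mulr_ge0 ?nrm_ge0.
apply: cnorm_small_eq0 => eps e0.
have [r hr] := decay_mul_small _ _ n0 e0.
have s1 : (osize supp 1%R < (osize supp C).+1)%N by rewrite /osize supp1 cardfs0.
have w1 : omega 1 = 1 by case: homega => _ [].
have d1 : dist_ge (odist supp 1 1) (r + odiam supp C)%N.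
  by rewrite /odist; apply: dist_ge_sdist => x y; rewrite supp1 inE.
have := hK C 1 1 _ (ltnSn _) s1 s1 d1.
rewrite w1 !mulr1 subrr sub0r cnormN => h; apply: le_lt_trans h _.
by apply: hr; rewrite addnK.
Qed.

(** The pairs [B, iota z E] and [iota y B, iota (y + z) E] are equally far apart, so both have small
    clustering defects. By invariance of the form these defects differ only in the values of
    [omega]. *)
Lemma omega_separated C B E (eps : Rl) : 0 < eps -> exists R, forall y z,
  (R <= l1 z)%N -> cnorm (form C B * (omega (iota z E) - omega (iota (y + z) E))
    + form C E * (omega B - omega (iota y B))) < eps.
Proof.
move=> e0; have [K K0 hK] := hdecay (osize supp C + osize supp B + osize supp E).+1.
have [M1 hM1] := fset_bounded _ (supp B); have [M2 hM2] := fset_bounded _ (supp E).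
set N := K * (nrm C * nrm B * nrm E).
have N0 : 0 <= N by rewrite !mulr_ge0 ?nrm_ge0.
have e2 : 0 < eps / 2 by rewrite divr_gt0.
have [r hr] := decay_mul_small _ _ N0 e2.
exists (r + 2 * (M1 + M2) + odiam supp C)%N => y z hz.
pose defect y := form C (iota y B * iota (y + z) E)
  - form C (iota y B) * omega (iota (y + z) E) - form C (iota (y + z) E) * omega (iota y B).
have hdef y' : cnorm (defect y') < eps / 2.
  have h := hK C (iota y' B) (iota (y' + z) E) (l1 z - 2 * (M1 + M2))%N.
  rewrite !osize_iota !(iota_nrm hO) in h.
  apply: le_lt_trans (h _ _ _ _) (hr _ _); last by lia.
  - by rewrite ltnS -addnA leq_addr.
  - by rewrite ltnS addnAC leq_addl.
  - by rewrite ltnS leq_addl.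
  rewrite /odist !(iota_supp hO); apply: dist_stransl => u.
    by move/hM1 => hu; apply: leq_trans hu (leq_addr _ _).
  by move/hM2 => hu; apply: leq_trans hu (leq_addl _ _).
have -> : form C B * (omega (iota z E) - omega (iota (y + z) E))
    + form C E * (omega B - omega (iota y B)) = defect y - defect 0.
  rewrite /defect add0r (Defs.iota0 hO) -!(Defs.iotaD hO) -(iota_mul hO) !form_iota; ring.
by apply: le_lt_trans (cnormB _ _) _; have := hdef y; have := hdef 0; lra.
Qed.

(* Whenever [form] is nonzero, [omega] is translation invariant. *)
Lemma omega_transl C E B y : (1 <= D)%N ->
  form C E * (omega (iota y B) - omega B) = 0.
Proof.
move=> hD; have [->|cE] := eqVneq (form C E) 0; first by rewrite mul0r.
have far R : exists2 z : site D, (R <= l1 z)%N & (R <= l1 (z + z)%R)%N.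
  pose z : site D := const_mx R%:Z.
  have hz (w : site D) : (forall i, R <= `|w ord0 i|)%N -> (R <= l1 w)%N.
    move=> h; rewrite /l1 (bigD1 (Ordinal hD)) //=.
    by apply: leq_trans (leq_addr _ _); apply: (leq_trans _ (h _)).
  by exists z; apply: hz => i; rewrite !mxE; lia.
(* With [B = E], the near-relations for the shifts [(x, z)], [(x, 2z)], [(x + z, z)] and [(z, z)]
   combine so that every value of [omega] at a far translate cancels. *)
have ident (c g0 gx gz gxz gzz gxzz : Cx) :
    c * (gz - gxzz + (g0 - gxz)) - c * (gz - gzz + (g0 - gz)) -
    (c * (gz - gxz + (g0 - gx)) + c * (gzz - gxzz + (g0 - gx))) =
    2%:R * (c * (gx - g0)) by ring.
have invE x : omega (iota x E) = omega E.
  apply/eqP; rewrite -subr_eq0; apply/eqP/(mulfI cE); rewrite mulr0.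
  apply: cnorm_small_eq0 => eps e0.
  have e2 : 0 < eps / 2 by rewrite divr_gt0.
  have [R hR] := omega_separated C E E _ e2.
  have [z hz hzz] := far R.
  have h1 := hR x z hz; have h2 := hR x (z + z) hzz.
  have h3 := hR (x + z) z hz; have h4 := hR z z hz.
  move: h1 h2 h3 h4; rewrite -!mulrDr (addrA x z z).
  set c := form C E; set g0 := omega E; set gx := omega (iota x E).
  set gz := omega (iota z E); set gxz := omega (iota (x + z) E).
  set gzz := omega (iota (z + z) E); set gxzz := omega (iota (x + z + z) E).
  set t1 := c * _; set t2 := c * _; set t3 := c * _; set t4 := c * _.
  move=> h1 h2 h3 h4.
  have : cnorm ((t3 - t4) - (t1 + t2)) < 2 * eps.
    apply: le_lt_trans (cnormB _ _) _.
    by have := cnormB t3 t4; have := cnormD t1 t2; lra.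
  have -> : (t3 - t4) - (t1 + t2) = 2%:R%:C%C * (c * (gx - g0)).
    by rewrite rmorph_nat; apply: ident.
  by rewrite cnormM cnormR ger0_norm // ltr_pM2l.
apply: cnorm_small_eq0 => eps e0.
have [R hR] := omega_separated C B E _ e0.
have [z hz _] := far R.
(* Invariance of [omega] on [E] removes the bracket multiplying [form C B]. *)
have := hR y z hz; rewrite !invE subrr mulr0 add0r.
by rewrite -(opprB (omega B)) mulrN cnormN.
Qed.

(** Exchanges the [omega A] in [corr] for the [omega (iota y A)] that clustering produces;
    [omega_transl] kills the difference. *)
Lemma form_corr C A B y : (1 <= D)%N ->
  form C (corr A B y) = form C (iota y A * B) - form C (iota y A) * omega B
    - form C B * omega (iota y A).
Proof.
move=> hD; rewrite !formR form_iota; have := omega_transl C B A y hD.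
move: (form C _) (form C _) (form C _) (omega _) (omega _) (omega _).
move=> cA cAB cB wA wyA wB /eqP; rewrite mulrBr subr_eq0 => /eqP ->.
by ring.
Qed.

(** The constants depend on [C] only through its size bound [l], so [C] may itself be one of the
    terms [corr A B x]. *)
Lemma corr_decay A B l : (1 <= D)%N -> exists K, exists2 M : nat, 0 <= K &
  forall C y, (osize supp C < l)%N ->
  cnorm (form C (corr A B y)) <= K * nrm C * decay p (l1 y - M - odiam supp C).
Proof.
move=> hD; have [K K0 hK] := hdecay ((osize supp A + osize supp B).+1 + l).
have [M1 hM1] := fset_bounded _ (supp A); have [M2 hM2] := fset_bounded _ (supp B).
exists (K * (nrm A * nrm B)), (2 * (M1 + M2))%N; first by rewrite !mulr_ge0 ?nrm_ge0.
move=> C y hC; rewrite form_corr //.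
have h := hK C (iota y A) B (l1 y - 2 * (M1 + M2))%N.
rewrite osize_iota (iota_nrm hO) in h.
have -> : K * (nrm A * nrm B) * nrm C = K * (nrm C * nrm A * nrm B) by ring.
apply: h; first exact: ltn_addl.
- by apply: ltn_addr; rewrite ltnS leq_addr.
- by apply: ltn_addr; rewrite ltnS leq_addl.
(* [B] is viewed as its translate by [y - y], so that [dist_stransl] applies with [z = - y]. *)
rewrite /odist -[B](Defs.iota0 hO) -(subrr y) !(iota_supp hO) -(l1N _ y).
apply: dist_stransl => u.
  by move/hM1 => hu; apply: leq_trans hu (leq_addr _ _).
by move/hM2 => hu; apply: leq_trans hu (leq_addl _ _).
Qed.

(** [corr_decay] is applied with [C] the term of smaller radius, whose diameter exceeds that radius
    by at most a constant; conjugate symmetry covers the other order. *)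
Lemma corr_corr_decay A B : (1 <= D)%N -> exists K, exists2 M : nat, 0 <= K &
  forall x y, cnorm (form (corr A B x) (corr A B y)) <=
    K * decay p ((l1 y - l1 x) + (l1 x - l1 y) - M).
Proof.
move=> hD.
have [K [M K0 hK]] := corr_decay A B (osize supp A + osize supp B).+1 hD.
have [M1 hM1] := fset_bounded _ (supp A); have [M2 hM2] := fset_bounded _ (supp B).
have n0 := mulr_ge0 (nrm_ge0 A) (nrm_ge0 B).
exists (K * (3 * (nrm A * nrm B))), (M + 2 * (M1 + M2))%N.
  by rewrite !mulr_ge0 ?nrm_ge0.
have main x y : (l1 x <= l1 y)%N -> cnorm (form (corr A B x) (corr A B y)) <=
    K * (3 * (nrm A * nrm B)) * decay p ((l1 y - l1 x) + (l1 x - l1 y) - (M + 2 * (M1 + M2))).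
  move=> xy; apply: le_trans (hK _ _ _) _; first by rewrite ltnS osize_corr.
  have hdiam : (odiam supp (corr A B x) <= l1 x + 2 * (M1 + M2))%N.
    apply: (sdiam_stranslU _ _ _ _ _ _ (supp_corr A B x)) => u.
      by move/hM1 => hu; apply: leq_trans hu (leq_addr _ _).
    by move/hM2 => hu; apply: leq_trans hu (leq_addl _ _).
  rewrite -!mulrA ler_wpM2l // !mulrA -[3 * _ * _]mulrA.
  apply: ler_pM; rewrite ?nrm_ge0 ?decay_ge0 ?nrm_corr //.
  apply: decay_nonincreasing; [exact: p_ge0 | lia].
move=> x y; have [xy|/ltnW yx] := leqP (l1 x) (l1 y); first exact: main.
rewrite (form_conj _ _ formL formR form_pos (corr A B y)) cnorm_conj addnC.
exact: main.
Qed.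

Definition corr_sum A B L : O := \sum_(x <- ball D L) corr A B x.

(** The decay is summable in the radius after a shift by [M] plus the diameter of [C]; only the
    sphere count survives. *)
Lemma corr_sum_first_moment A B C : (1 <= D)%N -> exists2 K, 0 <= K &
  forall L, (0 < L)%N -> cnorm (form C (corr_sum A B L)) <= K * L%:R ^+ D.-1.
Proof.
move=> hD; have [K [M K0 hK]] := corr_decay A B (osize supp C).+1 hD.
have [H [H0 hH]] := decay_summable _ p1.
have d1 d : decay p d <= 1 := decay_nonincreasing p 0 d p_ge0 (leq0n d).
set c := (M + odiam supp C)%N.
exists ((2 * 3 ^ D.-1)%:R * (K * nrm C * (c%:R + H))).
  by rewrite !mulr_ge0 ?nrm_ge0 ?addr_ge0.
move=> L L0; rewrite /corr_sum (form_sum_r _ _ formR).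
apply: le_trans (cnorm_sum _ _ _) _.
apply: (@le_trans _ _ (\sum_(x <- ball D L) K * nrm C * decay p (l1 x - c))).
  by apply: ler_sum => x _; rewrite /c subnDA hK.
apply: le_trans (sum_ball_le _ _ (fun r => K * nrm C * decay p (r - c)) _ _ _) _ => //.
  by move=> n; rewrite !mulr_ge0 ?nrm_ge0 ?decay_ge0.
rewrite [leRHS]mulrAC ler_wpM2l ?mulr_ge0 ?exprn_ge0 // -mulr_sumr.
rewrite ler_wpM2l ?mulr_ge0 ?nrm_ge0 //.
by apply: sum_shift_le => // d; apply: decay_ge0.
Qed.

(** For fixed [x], decay in the difference of radii makes the sum over [y] of order [L ^ (D - 1)];
    summing over [x] contributes the volume [L ^ D]. *)
Lemma corr_sum_second_moment A B : (1 <= D)%N -> exists2 K, 0 <= K &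
  forall L, (0 < L)%N ->
  complex.Re (form (corr_sum A B L) (corr_sum A B L)) <= K * (L%:R ^+ D.-1) ^+ 2 * L%:R.
Proof.
move=> hD; have [K [M K0 hK]] := corr_corr_decay A B hD.
have [H [H0 hH]] := decay_summable _ p1.
have d1 d : decay p d <= 1 := decay_nonincreasing p 0 d p_ge0 (leq0n d).
set V : Rl := (2 * 3 ^ D.-1)%:R; have V0 : 0 <= V by [].
(* Each [V] is a sphere count, [2 * (M + H)] bounds the two-sided sum of shifted decays, and the
   last 2 comes from [L + 1 <= 2L]. *)
exists (V * (V * (K * (2 * (M%:R + H))) * 2)).
  by rewrite !mulr_ge0 ?addr_ge0.
move=> L L0; apply: le_trans (ler_norm _) _; apply: le_trans (ge_absRe_cnorm _) _.
rewrite /corr_sum (form_sum_l _ _ formL); apply: le_trans (cnorm_sum _ _ _) _.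
set w : Rl := L%:R ^+ D.-1; have w0 : 0 <= w by rewrite exprn_ge0.
set b := V * w * (K * (2 * (M%:R + H))).
have b0 : 0 <= b by rewrite !mulr_ge0 ?addr_ge0.
apply: (@le_trans _ _ (\sum_(x <- ball D L) b)).
  apply: ler_sum => x _; rewrite (form_sum_r _ _ formR).
  apply: le_trans (cnorm_sum _ _ _) _.
  pose g r := K * decay p ((r - l1 x) + (l1 x - r) - M).
  apply: (@le_trans _ _ (\sum_(y <- ball D L) g (l1 y))).
    by apply: ler_sum => y _; apply: hK.
  apply: le_trans (sum_ball_le _ _ g _ _ _) _ => //.
    by move=> n; rewrite !mulr_ge0 ?decay_ge0.
  rewrite /b ler_wpM2l ?mulr_ge0 // -mulr_sumr ler_wpM2l //.
  apply: (sum_absdiff_le (fun d => decay p (d - M))) => [d|N]; first exact: decay_ge0.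
  by apply: sum_shift_le => // d; apply: decay_ge0.
apply: le_trans (sum_ball_le _ _ (fun=> b) _ _ _) _ => //.
rewrite big_const_nat subn0 iter_addr_0 -/V -/w -[b *+ _]mulr_natl.
have hL : (L.+1%:R : Rl) <= 2 * L%:R by rewrite -natrM ler_nat; lia.
apply: (@le_trans _ _ (V * w * (2 * L%:R * b))).
  by rewrite ler_wpM2l ?mulr_ge0 // ler_wpM2r.
by rewrite /b le_eqVlt; apply/orP; left; apply/eqP; ring.
Qed.

(** * The limit functional and its weak clustering *)

Section Limit.
Variables (a : nat -> O) (P : O -> Cx).
Hypothesis hP : forall B, ccvg (fun n => form (a n) B) (P B).
Hypothesis hunif : forall eps : Rl, 0 < eps -> exists N, forall n B, (N <= n)%N ->
  cnorm (P B - form (a n) B) <= eps * seminorm form B.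

Lemma limit_lin (c : Cx) A B : P (c *: A + B) = c * P A + P B.
Proof.
apply: ccvg_unique (hP _) _ => eps e0.
have [N hN] := ccvg_lin c _ _ _ _ (hP A) (hP B) eps e0.
by exists N => n hn; rewrite formR; apply: hN.
Qed.

Lemma limit_iota x A : P (iota x A) = P A.
Proof.
apply: ccvg_unique (hP _) _ => eps e0; have [N hN] := hP A eps e0.
by exists N => n hn; rewrite form_iota; apply: hN.
Qed.

Lemma limit1 : P 1 = 0.
Proof.
apply: ccvg_unique (hP _) _ => eps e0.
by exists 0%N => n _; rewrite form1r subrr cnorm0.
Qed.

(** Diagonal case of boundedness (II); it turns the approximation error into a multiple of the norm
    for observables of bounded size. *)
Lemma seminorm_bounded l : exists2 k, 0 <= k &
  forall A, (osize supp A < l)%N -> seminorm form A <= k * nrm A.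
Proof.
have [->|l0] := posnP l; first by exists 0.
case: hform => _ [_ [_ [_ [_ hbd]]]].
have [k [k0 hk]] := hbd l l0.
exists (Num.sqrt k) => [|A hA]; first exact: sqrtr_ge0.
rewrite -[nrm A]ger0_norm ?nrm_ge0 // -sqrtr_sqr -sqrtrM ?(ltW k0) //.
apply: ler_wsqrtr; apply: le_trans (ler_norm _) _.
by apply: le_trans (ge_absRe_cnorm _) _; rewrite expr2 mulrA; apply: hk.
Qed.

(** The approximant [C = a N] is fixed from [eps], [l] and [w] before the distance [r], so [r] is
    uniform in [A] and [B]. *)
Lemma limit_factorizes (l : nat) (w : Rl) : (0 < l)%N -> 0 < w ->
  forall eps : Rl, 0 < eps -> exists r : nat, forall A B : O,
    (osize supp A < l)%N -> (osize supp B < l)%N -> nrm A < w -> nrm B < w ->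
    dist_ge (odist supp A B) r ->
    cnorm (P (A * B) - (P A * omega B + P B * omega A)) < eps.
Proof.
move=> l0 w0 eps e0.
have [k k0 hk] := seminorm_bounded (l + l).
have kw0 : 0 <= k * (w * w) by rewrite !mulr_ge0 ?(ltW w0).
(* Replacing [P] by [form C] costs three errors of size [e * k * w ^ 2]; the 6 keeps their sum below
   [eps / 2], and the 1 keeps the divisor positive. *)
have t0 : 0 < 6 * (k * (w * w)) + 1 by lra.
have [N hN] := hunif _ (divr_gt0 e0 t0).
set e := eps / _ in hN; have e1 : 0 < e by rewrite divr_gt0.
have he : 3 * (e * (k * (w * w))) <= eps / 2.
  have : e * (6 * (k * (w * w)) + 1) = eps by rewrite divfK // gt_eqF.
  by rewrite mulrDr mulr1; lra.
set C := a N.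
have [K K0 hK] := hdecay (l + (osize supp C).+1).
have K1 : 0 <= K * (nrm C * w * w) by rewrite !mulr_ge0 ?nrm_ge0 ?(ltW w0).
have e2 : 0 < eps / 2 by rewrite divr_gt0.
have [r hr] := decay_mul_small _ _ K1 e2.
exists (r + odiam supp C)%N => A B hA hB nA nB hd.
have A0 := nrm_ge0 A; have B0 := nrm_ge0 B; have C0 := nrm_ge0 C.
have main : cnorm (form C (A * B) - form C A * omega B - form C B * omega A) < eps / 2.
  have hr' := hr r (leqnn r).
  apply: le_lt_trans hr'; apply: le_trans
    (hK C A B _ (ltn_addl _ (ltnSn _)) (ltn_addr _ hA) (ltn_addr _ hB) hd) _.
  rewrite addnK ler_wpM2r ?decay_ge0 // ler_wpM2l //.
  by rewrite !ler_pM ?mulr_ge0 // ltW.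
have approx X : (osize supp X < l + l)%N -> cnorm (P X - form C X) <= e * (k * nrm X).
  move=> hX; apply: le_trans (hN N X (leqnn N)) _.
  by rewrite ler_wpM2l ?(ltW e1) // hk.
have ek0 : 0 <= e * k by rewrite mulr_ge0 // ltW.
have h1 : cnorm (P (A * B) - form C (A * B)) <= e * (k * (w * w)).
  apply: le_trans (approx _ (osizeM_lt _ _ _ _ hA hB)) _.
  rewrite !mulrA -[leRHS]mulrA ler_wpM2l //; apply: le_trans (nrm_mul hO _ _) _.
  by rewrite ler_pM // ltW.
have prod X Y : nrm X < w -> nrm Y < w -> (osize supp X < l)%N ->
    cnorm ((P X - form C X) * omega Y) <= e * (k * (w * w)).
  move=> nX nY hX; rewrite cnormM.
  have hx : cnorm (P X - form C X) <= e * (k * w).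
    apply: le_trans (approx _ (ltn_addr _ hX)) _.
    by rewrite !mulrA ler_wpM2l // ltW.
  have -> : e * (k * (w * w)) = e * (k * w) * w by ring.
  by rewrite ler_pM ?cnorm_ge0 // (le_trans (cnorm_omega _)) // ltW.
have h2 := prod A B nA nB hA; have h3 := prod B A nB nA hB.
have -> : P (A * B) - (P A * omega B + P B * omega A) =
  (form C (A * B) - form C A * omega B - form C B * omega A)
  + ((P (A * B) - form C (A * B)) - ((P A - form C A) * omega B + (P B - form C B) * omega A)).
  by ring.
apply: le_lt_trans (cnormD _ _) _.
have := cnormB (P (A * B) - form C (A * B))
  ((P A - form C A) * omega B + (P B - form C B) * omega A).
have := cnormD ((P A - form C A) * omega B) ((P B - form C B) * omega A).
lra.
Qed.

Lemma limit_sum_corr A B L :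
  \sum_(x <- ball D L) (P (iota x A * B) - P A * omega B - P B * omega A) =
  P (corr_sum A B L).
Proof.
have P0 : P 0 = 0.
  have := limit_lin 1 0 0; rewrite scaler0 addr0 mul1r => h.
  by apply: (addrI (P 0)); rewrite -h addr0.
have PD X Y : P (X + Y) = P X + P Y by rewrite -[X]scale1r limit_lin mul1r scale1r.
rewrite /corr_sum (big_morph P PD P0); apply: eq_bigr => x _.
rewrite /corr !limit_lin limit_iota; ring.
Qed.

(** The order of choices matters: [K2] depends on [A] and [B] only and fixes [e], hence [N]; [K1]
    depends on [a N] and affects only how large [L] must be. *)
Lemma limit_fluctuations A B (eps : Rl) : (1 <= D)%N -> 0 < eps ->
  exists L0 : nat, forall L : nat, (L0 <= L)%N ->
  cnorm (((Num.sqrt (L%:R : Rl) / (L%:R ^+ D))%:C)%C *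
     \sum_(x <- ball D L) (P (iota x A * B) - P A * omega B - P B * omega A)) < eps.
Proof.
move=> hD e0; have [K2 K20 h2] := corr_sum_second_moment A B hD.
have s0 : 0 <= Num.sqrt K2 := sqrtr_ge0 _.
have t0 : 0 < 2 * (Num.sqrt K2 + 1) by lra.
have [N hN] := hunif _ (divr_gt0 e0 t0).
set e := eps / _ in hN; have e1 : 0 < e by rewrite divr_gt0.
have he : e * Num.sqrt K2 <= eps / 2.
  have : e * (2 * (Num.sqrt K2 + 1)) = eps by rewrite divfK // gt_eqF.
  by lra.
have [K1 K10 h1] := corr_sum_first_moment A B (a N) hD.
(* Once the square root of [L] exceeds [t], the first-moment bound [K1 * v] falls below
   [eps / 2 * (v * u)]. *)
set t := 2 * K1 / eps; have tge0 : 0 <= t by rewrite divr_ge0 ?mulr_ge0 // ltW.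
exists (Num.bound (t ^+ 2)).+1 => L hL.
have L0 : (0 < L)%N by apply: leq_trans hL.
have Lp : 0 < (L%:R : Rl) by rewrite ltr0n.
have tL : t < Num.sqrt (L%:R : Rl).
  rewrite -[t]ger0_norm // -sqrtr_sqr ltr_sqrt //.
  apply: lt_le_trans (archi_boundP (sqr_ge0 t)) _.
  by rewrite ler_nat ltnW.
rewrite limit_sum_corr cnormM cnormR.
set u := Num.sqrt (L%:R : Rl) in tL *; set v : Rl := L%:R ^+ D.-1.
have u0 : 0 < u by rewrite sqrtr_gt0.
have v0 : 0 < v by rewrite exprn_gt0.
have uu : u * u = L%:R by rewrite -expr2 sqr_sqrtr // ltW.
(* The normalization becomes the inverse of [u * v], which is [L] to the power [D - 1/2]. *)
have -> : L%:R ^+ D = u * u * v by rewrite uu /v -exprS prednK.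
have -> : u / (u * u * v) = (u * v)^-1 by field; rewrite !gt_eqF.
rewrite ger0_norm ?invr_ge0 ?mulr_ge0 ?ltW // ltr_pdivrMl ?mulr_gt0 //.
set S := corr_sum A B L.
have hS : seminorm form S <= Num.sqrt K2 * (v * u).
  have -> : Num.sqrt K2 * (v * u) = Num.sqrt (K2 * v ^+ 2 * L%:R).
    rewrite [RHS]sqrtrM ?mulr_ge0 ?(ltW v0) // [Num.sqrt (K2 * _)]sqrtrM // sqrtr_sqr.
    by rewrite ger0_norm ?(ltW v0) // mulrA.
  by rewrite /seminorm; apply: ler_wsqrtr; apply: h2.
have hPS : cnorm (P S - form (a N) S) <= e * Num.sqrt K2 * (v * u).
  apply: le_trans (hN N S (leqnn N)) _.
  by rewrite -mulrA ler_wpM2l // ltW.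
have hPS' : cnorm (P S - form (a N) S) <= eps / 2 * (v * u).
  by apply: le_trans hPS _; rewrite ler_wpM2r // mulr_ge0 // ltW.
have hfS : cnorm (form (a N) S) < eps / 2 * (v * u).
  apply: le_lt_trans (h1 L L0) _; rewrite -/v mulrC [v * u]mulrC mulrA mulrC.
  rewrite ltr_pM2r //; move: tL; rewrite /t ltr_pdivrMr //; lra.
have -> : P S = (P S - form (a N) S) + form (a N) S by rewrite subrK.
apply: le_lt_trans (cnormD _ _) _; rewrite [u * v]mulrC; lra.
Qed.

End Limit.

End QuasiLocal.

Theorem theorem4p8 (D : nat) (hD : (1 <= D)%N)
  (O : algType Cx) (star : O -> O) (nrm : O -> Rl)
  (loc : {fset site D} -> O -> Prop) (supp : O -> {fset site D})
  (iota : site D -> O -> O)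
  (hO : quasi_local star nrm loc supp iota)
  (omega : O -> Cx) (homega : is_state star nrm omega)
  (form : O -> O -> Cx) (hform : clustering_form nrm supp iota omega form)
  (a : nat -> O) (ha : form_cauchy form a) :
  exists P : O -> Cx,
    (forall B : O, ccvg (fun n => form (a n) B) (P B)) /\
    weakly_clustering nrm supp iota omega P.
Proof.
have [p p1 hdecay] := clustering_decay _ _ _ _ _ _ _ hO _ homega _ hform hD.
have [P [hP hunif]] := cauchy_form_cvg _ _ (formL _ _ _ _ _ _ _ hform)
  (formR _ _ _ _ _ _ _ hform) (form_pos _ _ _ _ _ _ _ hform) _ ha.
exists P; split=> //; split; last split; last split; last split.
- exact: (limit_lin _ _ _ _ _ _ _ hform _ _ hP).
- exact: (limit_iota _ _ _ _ _ _ _ hform _ _ hP).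
- exact: (limit1 _ _ _ _ _ _ _ hO _ homega _ _ p1 hdecay _ _ hP).
- exact: (limit_factorizes _ _ _ _ _ _ _ hO _ homega _ hform _ p1 hdecay _ _ hunif).
- move=> A B eps.
  exact: (limit_fluctuations _ _ _ _ _ _ _ hO _ homega _ hform _ p1 hdecay _ _ hP hunif
    A B eps hD).
Qed.
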